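(* Let $X=c_0$ or $X=\ell_p$ with $p\in[1,+\infty]$. Then $Z(X)$ is maximal lineable; that is, $Z(X)\cup\{0\}$ contains a linear subspace of $X$ of dimension $\dim(X)$.
   Context: All sequence spaces are over $\mathbb{C}$. For a sequence space $X$, $Z(X)$ denotes the set of all sequences in $X$ having only finitely many zero coordinates. Dimension means algebraic (Hamel) dimension. *)

(* Defs.v *)
From HB Require Import structures.
From mathcomp Require Import all_boot all_order all_algebra finmap complex.
From mathcomp Require Import all_classical all_reals all_analysis.

Set Implicit Arguments.
Unset Strict Implicit.
Unset Printing Implicit Defensive.

Import Order.TTheory GRing.Theory Num.Theory.
Import numFieldNormedType.Exports.
Import Normc.

Local Open Scope classical_set_scope.
Local Open Scope ring_scope.

Section LinearAlgebra.
Context {K : fieldType} {E : lmodType K}.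
Implicit Types (B M V W X : set E).

Definition linear_subspace V := submod_closed [in V].

Definition linear_span B : set E :=
  [set v | exists (s : {fset E}) (c : E -> K),
    [set` s] `<=` B /\ v = \sum_(u <- s) c u *: u].

Definition linearly_independent B :=
  forall (s : {fset E}) (c : E -> K), [set` s] `<=` B ->
    \sum_(u <- s) c u *: u = 0 -> forall u, u \in s -> c u = 0.

Definition hamel_basis B V := linearly_independent B /\ linear_span B = V.

(* Every vector space has a Hamel basis, and any two of them are equipotent, so
   exhibiting one equipotent pair of bases is equality of Hamel dimensions. *)
Definition same_dim V W := exists B C : set E,
  [/\ hamel_basis B V, hamel_basis C W & (B #= C)%card].

Definition maximal_lineable X M := exists V : set E,
  [/\ linear_subspace V, V `<=` X, V `<=` M `|` [set 0] & same_dim V X].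

End LinearAlgebra.

Section SequenceSpaces.
Context (R : realType).
Local Notation C := R[i].

(* [normc] is the modulus with values in R, whereas [`|z|] lives in R[i]. *)
Definition c0 : set (nat -> C) :=
  [set x | normc (x n) @[n --> \oo] --> (0 : R)].

(* For finite p >= 1 this is summability of |x_n|^p (Lnorm_counting); for
   p = +oo it is boundedness, null sets of the counting measure being empty. *)
Definition ell (p : \bar R) : set (nat -> C) :=
  [set x | (Lnorm counting p (fun n => (normc (x n))%:E) < +oo)%E].

Definition Z (X : set (nat -> C)) : set (nat -> C) :=
  [set x | X x /\ finite_set [set n | x n = 0]].
End SequenceSpaces.

Arguments c0 R : clear implicits.

(* Main.v *)
Require Import Defs.
From mathcomp Require Import all_boot all_order all_algebra finmap complex.
From mathcomp Require Import all_classical all_reals all_analysis.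
From mathcomp Require Import ess_sup_inf lra.
Import Order.TTheory GRing.Theory Num.Theory.
Local Open Scope classical_set_scope.
Local Open Scope ring_scope.

(** The witness is the span of the geometric sequences [(t ^ n)_n] with
    [0 < t < 1].

    Take a combination [sum_i c_i * t_i ^ n] with distinct rates and not all
    [c_i] zero, and let [t_m] be the largest rate with a nonzero coefficient.
    After division by [t_m ^ n] the term of index [m] has constant modulus
    [|c_m| > 0] while all the others tend to 0, so the combination vanishes for
    finitely many [n] only ([exponential_sum_finite_zeros]). This one estimate
    shows both that the geometric sequences are linearly independent and that
    every nonzero element of their span has finitely many zero coordinates.
    Each of the spaces in question is a linear subspace containing all these
    sequences, hence it contains their span.

    As for dimensions, Zorn's lemma extends the geometric family to a Hamel
    basis [B] of the whole space ([hamel_basis_extension]). There are at most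
    continuum many complex sequences, and they can be embedded in the open
    unit interval ([complex_sequences_embed]), which parametrizes the geometric family. So
    [B] and the geometric family embed in each other, and the Cantor-Bernstein
    theorem concludes. *)

(** * Hamel bases *)

Section HamelBases.
Context {K : fieldType} {E : lmodType K}.
Implicit Types (B C V X : set E).

Lemma linear_subspaceP V : linear_subspace V <->
  V 0 /\ forall a u v, V u -> V v -> V (a *: u + v).
Proof.
split=> -[V0 VL]; split=> [|a u v]; rewrite ?inE//; last exact: VL.
  by move: V0; rewrite inE.
by move=> Vu Vv; have := VL a u v; rewrite !inE; apply.
Qed.

Lemma linear_span_subspace B : linear_subspace (linear_span B).
Proof.
apply/linear_subspaceP; split=> [|a _ _ [s [c [sB ->]]] [s' [c' [s'B ->]]]].
  exists fset0, (fun=> 0); split; first by move=> x /=; rewrite inE.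
  by rewrite big_seq_fset0.
(* Coefficients are functions on the whole space, so those of the two
   combinations must be cut off outside their own supports. *)
pose d w := a * (if w \in s then c w else 0) + (if w \in s' then c' w else 0).
exists (s `|` s')%fset, d; split.
  by move=> w /=; rewrite inE => /orP[/sB|/s'B].
under [RHS]eq_bigr do rewrite scalerDl -scalerA.
rewrite big_split -scaler_sumr; congr (_ *: _ + _).
- rewrite -[RHS](@big_fset_incl _ _ _ _ s) ?fsubsetUl//.
    by apply: eq_big_seq => w ws /=; rewrite ws.
  by move=> w _ /negbTE ->; rewrite scale0r.
- rewrite -[RHS](@big_fset_incl _ _ _ _ s') ?fsubsetUr//.
    by apply: eq_big_seq => w ws /=; rewrite ws.
  by move=> w _ /negbTE ->; rewrite scale0r.
Qed.

Lemma sub_linear_span B : B `<=` linear_span B.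
Proof.
move=> x Bx; exists [fset x]%fset, (fun=> 1); split.
  by move=> y /=; rewrite inE => /eqP ->.
by rewrite big_seq_fset1 scale1r.
Qed.

Lemma linear_span_min B X :
  linear_subspace X -> B `<=` X -> linear_span B `<=` X.
Proof.
move=> /linear_subspaceP[X0 XL] BX x [s [c [sB ->]]].
rewrite big_seq; apply: big_ind => // [u v uX vX|u /sB /BX uX].
  by rewrite -[u]scale1r; exact: XL.
by rewrite -[_ *: _]addr0; exact: XL.
Qed.

(** In a relation that involves [x], a nonzero coefficient at [x] could be
    inverted, which would express [x] in terms of [B]. *)
Lemma linearly_independentU1 B x : linearly_independent B ->
  ~ linear_span B x -> linearly_independent (B `|` [set x]).
Proof.
move=> indB xB s c sBx cs0.
have [xs|xs] := boolP (x \in s); last first.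
  apply: (indB) => // u us; have /sBx[//|/= ux] := us.
  by rewrite -ux us in xs.
have sB : [set` (s `\ x)%fset] `<=` B.
  by move=> u /=; rewrite !inE => /andP[ux /sBx[//|/= /eqP]];
    rewrite (negbTE ux).
move: cs0; rewrite (big_fsetD1 x)//= => cs0.
have [cx0 u us|cx0] := eqVneq (c x) 0; last first.
  exfalso; apply: xB.
  exists (s `\ x)%fset, (fun u => - (c x)^-1 * c u); split=> //.
  under eq_bigr do rewrite -scalerA.
  rewrite -scaler_sumr scaleNr.
  move/eqP: cs0; rewrite addr_eq0 => /eqP/(congr1 ( *:%R (c x)^-1)).
  by rewrite scalerA mulVf// scale1r scalerN.
have [->//|ux] := eqVneq u x.
apply: (indB (s `\ x)%fset c) => //; last by rewrite !inE ux us.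
by move: cs0; rewrite cx0 scale0r add0r.
Qed.

(** The classical exchange argument: by [linearly_independentU1] a maximal
    independent set between [C] and [X] spans [X]. Zorn's lemma is applied to
    the sets [A] of vectors to be added to [C], so that the empty chain is
    covered by the independence of [C] itself. *)
Lemma hamel_basis_extension C X : linear_subspace X -> C `<=` X ->
  linearly_independent C -> exists B, C `<=` B /\ hamel_basis B X.
Proof.
move=> Xsub CX indC.
pose P := [set A : set E | A `<=` X /\ linearly_independent (C `|` A)].
have [|A [[AX indA] maxA]] := @Zorn_bigcup _ P.
  move=> F FP Ftot; split; first by move=> x [A /FP[AX _] /AX].
  move=> s c sF.
  have [[A FA]|F0] := pselect (F !=set0); last first.
    apply: indC => u us; have /sF[//|[A FA _]] := us.
    by exfalso; apply: F0; exists A.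
  (* Finitely many members of the union of a chain lie in a single set of the
     chain. *)
  have subF (r : seq E) : {subset r <= s} ->
      exists2 D, F D & [set` r] `<=` C `|` D.
    elim: r => [_|u r IHr rs]; first by exists A.
    have [|D FD rD] := IHr.
      by move=> v vr; apply: rs; rewrite inE vr orbT.
    have us : u \in s by apply: rs; rewrite inE eqxx.
    have [Cu|[D' FD' D'u]] := sF _ us.
      exists D => // v /=; rewrite inE => /orP[/eqP ->|/rD//]; by left.
    have [DD'|D'D] := Ftot _ _ FD FD'.
      exists D' => // v /=; rewrite inE => /orP[/eqP ->|/rD[]]; first by right.
        by left.
      by move/DD'; right.
    exists D => // v /=; rewrite inE => /orP[/eqP ->|/rD//].
    by right; exact: D'D.
  have [D FD sD] := subF s (fun _ => id).
  by have [_] := FP _ FD; apply.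
exists (C `|` A); split; first by move=> x; left.
split=> //; apply/seteqP; split.
  by apply: linear_span_min => // x [/CX|/AX].
move=> x Xx; apply: contrapT => xspan.
apply: (maxA (A `|` [set x])).
  split; first by move=> y; left.
  move=> /(_ x (or_intror erefl)) Ax.
  by apply/xspan/sub_linear_span; right.
split; first by move=> y [/AX//|/= ->].
by rewrite setUA; exact: linearly_independentU1.
Qed.

End HamelBases.

(** * Combinations of geometric sequences *)

Section GeometricSequences.
Context {R : realType}.
Import numFieldNormedType.Exports Normc.

Lemma normc_real (x : R) : normc x%:C%C = `|x|.
Proof. by rewrite /= expr0n addr0 sqrtr_sqr. Qed.

Lemma normc_ge0 (z : R[i]) : 0 <= normc z.
Proof. by case: z => a b; exact: sqrtr_ge0. Qed.

Lemma normc_gt0 (z : R[i]) : z != 0 -> 0 < normc z.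
Proof.
by move=> z0; rewrite lt_def normc_ge0 andbT; apply: contra_neq z0 => /eq0_normc.
Qed.

Lemma normc_triangle (I : Type) (r : seq I) (P : pred I) (f : I -> R[i]) :
  normc (\sum_(i <- r | P i) f i) <= \sum_(i <- r | P i) normc (f i).
Proof.
elim/big_rec2: _ => [|i x y _ le_yx]; first by rewrite normc0.
by apply: le_trans (le_normcD _ _) _; rewrite lerD2l.
Qed.

(** The term with the largest rate among the nonzero coefficients dominates all
    the others from some rank on. *)
Lemma exponential_sum_finite_zeros (I : finType) (t : I -> R) (c : I -> R[i])
    (i0 : I) : injective t -> (forall i, 0 < t i) -> c i0 != 0 ->
  finite_set [set n | \sum_i c i * (t i ^+ n)%:C%C = 0].
Proof.
move=> t_inj t_gt0 c0.
have [m cm t_max] :=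
  @Order.TotalTheory.arg_maxP _ _ _ i0 (fun i => c i != 0) t c0.
(* [h n] bounds the sum of the other terms, relative to [t m ^+ n]. *)
pose h n := \sum_(i | i != m) normc (c i) * (t i / t m) ^+ n.
have h0 : h n @[n --> \oo] --> (0 : R).
  have -> : (0 : R) = \sum_(i | i != m) (0 : R) by rewrite big1.
  apply: cvg_big => [|i im]; first exact: add_continuous.
  (* A rate larger than [t m] can only occur with coefficient 0. *)
  have [->|ci] := eqVneq (c i) 0.
    rewrite normc0; under eq_fun do rewrite mul0r.
    exact: cvg_cst.
  rewrite -[X in _ --> X](mulr0 (normc (c i))).
  apply: cvgMl_tmp; apply: cvg_expr.
  have r_ge0 : 0 <= t i / t m by apply: divr_ge0; exact: ltW.
  rewrite ger0_norm// ltr_pdivrMr// mul1r lt_def [t i <= t m]t_max// andbT eq_sym.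
  by apply: contra_neq im => /t_inj.
have [N _ hN] : \forall n \near \oo, h n < normc (c m).
  exact: (cvgr_lt _ h0 _ (normc_gt0 _ cm)).
apply: (@sub_finite_set _ _ `I_N); last exact: finite_II.
move=> n /= sum0; rewrite ltnNge; apply/negP => /hN/=.
rewrite ltNge => /negP; apply.
have tm_gt0 : 0 < t m ^+ n by exact: exprn_gt0.
rewrite -(ler_pM2r tm_gt0) /h mulr_suml.
have -> : normc (c m) * t m ^+ n = normc (c m * (t m ^+ n)%:C%C).
  by rewrite normcM normc_real ger0_norm// ltW.
move: sum0; rewrite (bigD1 m)//= => /eqP; rewrite addr_eq0 => /eqP ->.
rewrite normcN; apply: le_trans (normc_triangle _ _ _ _) _.
apply: ler_sum => i _; rewrite normcM normc_real ger0_norm; last first.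
  by apply/exprn_ge0/ltW.
by rewrite -mulrA -exprMn divfK// gt_eqF.
Qed.

Definition geometric_sequence (t : R) : nat -> R[i] := fun n => (t ^+ n)%:C%C.

Lemma geometric_sequence_inj : injective geometric_sequence.
Proof.
by move=> s t /(congr1 (fun x => complex.Re (x 1%N))); rewrite /= !expr1.
Qed.

Definition geometric_family : set (nat -> R[i]) :=
  [set geometric_sequence t | t in [set t | 0 < t < 1]].

Lemma geometric_combination_finite_zeros (s : {fset (nat -> R[i])})
    (c : (nat -> R[i]) -> R[i]) u : [set` s] `<=` geometric_family ->
  u \in s -> c u != 0 -> finite_set [set n | (\sum_(v <- s) c v *: v) n = 0].
Proof.
move=> sG us cu0.
(* The rate of a geometric sequence is its coordinate of index 1. *)
pose t (v : s) := complex.Re (val v 1%N).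
have tE (v : s) : geometric_sequence (t v) = val v /\ 0 < t v.
  have [r /andP[r0 _] rv] := sG _ (valP v).
  by rewrite /t -rv /geometric_sequence/= expr1.
have t_inj : injective t.
  by move=> v w vw; apply/val_inj; rewrite -(tE v).1 -(tE w).1 vw.
have := @exponential_sum_finite_zeros _ t (fun v => c (val v)) [` us]%fset
  t_inj (fun v => (tE v).2) cu0.
congr finite_set; apply/eq_set => n; congr (_ = _).
rewrite big_seq_fsetE fct_sumE; apply: eq_bigr => v _.
by have /(congr1 (fun x => c (val v) * x n)) := (tE v).1.
Qed.

(** A linear relation with a nonzero coefficient would give the zero sequence
    finitely many zeros only. *)
Lemma geometric_family_independent : linearly_independent geometric_family.
Proof.
move=> s c sG sum0 u us; apply: contrapT => /eqP cu0.
have := geometric_combination_finite_zeros _ _ _ sG us cu0.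
rewrite sum0 (_ : [set n | _] = setT); first exact: infinite_nat.
by apply/seteqP; split.
Qed.

End GeometricSequences.

(** * The spaces c0 and l^p *)

Section SequenceSpaces.
Context {R : realType}.
Import numFieldNormedType.Exports Normc.

Lemma c0_subspace : linear_subspace (c0 R).
Proof.
apply/linear_subspaceP; split=> [|a u v u0 v0].
  by rewrite /c0/= expr0n addr0 sqrtr0; exact: cvg_cst.
apply: (@squeeze_cvgr _ _ _ _ (cst 0)
  (fun n => normc a * normc (u n) + normc (v n))).
- apply: nearW => n; rewrite normc_ge0/=.
  by apply: le_trans (le_normcD _ _) _; rewrite normcM.
- exact: cvg_cst.
- have := cvgD (cvgMl_tmp (a := normc a) u0) v0.
  by rewrite mulr0 addr0; apply.
Qed.

Lemma normc_geometric (t : R) n : 0 < t ->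
  normc (geometric_sequence t n) = t ^+ n.
Proof. by move=> t0; rewrite normc_real ger0_norm// exprn_ge0 ?ltW. Qed.

Lemma c0_geometric (t : R) : 0 < t < 1 -> c0 R (geometric_sequence t).
Proof.
move=> /andP[t0 t1].
suff : normc (geometric_sequence t n) @[n --> \oo] --> (0 : R) by [].
under eq_fun do rewrite normc_geometric//.
by apply: cvg_expr; rewrite ger0_norm// ltW.
Qed.

(** Every function on [nat] is measurable, so that membership in [ell p] is
    finiteness of the norm of the real sequence of moduli. This transfers
    Minkowski's inequality, in the form of the linear structure of [Lfun]. *)
Lemma ell_Lfun (p : \bar R) (x : nat -> R[i]) :
  ell p x <-> (fun n => normc (x n)) \in Lfun counting p.
Proof.
split=> [px|/andP[_]]; last by rewrite inE.
by apply/andP; split; rewrite inE.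
Qed.

Lemma le_Lnorm_counting (p : \bar R) (f g : nat -> R) : (1 <= p)%E ->
  (forall n, 0 <= f n <= g n) ->
  (Lnorm counting p (EFin \o f) <= Lnorm counting p (EFin \o g))%E.
Proof.
move=> p1 fg; have fgn n : `|f n| <= `|g n|.
  by have /andP[f0 fgn] := fg n; rewrite !ger0_norm// (le_trans f0).
case: p p1 => [r|_|//]; last first.
  rewrite unlock; case: ifPn => // _; apply: le_ess_sup.
  by apply/nearW => n /=; rewrite lee_fin.
rewrite lee_fin => r1; have r0 : 0 < r by exact: lt_le_trans r1.
rewrite !Lnorm_counting//.
apply: gt0_ler_poweR; rewrite ?invr_ge0 ?(ltW r0)//.
- by rewrite in_itv/= leey andbT nneseries_ge0// => n _ _; rewrite poweR_ge0.
- by rewrite in_itv/= leey andbT nneseries_ge0// => n _ _; rewrite poweR_ge0.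
apply: lee_nneseries => [n _ _|n _] /=; first by rewrite lee_fin powR_ge0.
by rewrite lee_fin; apply: ge0_ler_powR => //; rewrite ?nnegrE// ltW.
Qed.

Lemma ell_subspace (p : \bar R) : (1 <= p)%E ->
  linear_subspace (ell p : set (nat -> R[i])).
Proof.
move=> p1; apply/linear_subspaceP; split=> [|a u v /ell_Lfun u0 /ell_Lfun v0].
  suff : (Lnorm counting p (cst 0 : nat -> \bar R) < +oo)%E.
    by rewrite /ell/= expr0n addr0 sqrtr0.
  by rewrite Lnorm0 ?ltry// gt_eqF// (lt_le_trans _ p1).
have [_ lin] := @Lfun_submod_closed _ nat R counting p p1.
have /andP[_] := lin (normc a) _ _ u0 v0; rewrite inE.
apply: le_lt_trans; apply: le_Lnorm_counting => // n.
by rewrite normc_ge0/=; apply: le_trans (le_normcD _ _) _; rewrite normcM.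
Qed.

(** For finite [p >= 1] the terms satisfy [(t ^ n) ^ p <= t ^ n], so a
    convergent geometric series bounds the norm. *)
Lemma ell_geometric (p : \bar R) (t : R) : (1 <= p)%E -> 0 < t < 1 ->
  ell p (geometric_sequence t).
Proof.
move=> p1 /andP[t0 t1].
suff : (Lnorm counting p (fun n => (normc (geometric_sequence t n))%:E)
    < +oo)%E by [].
under eq_fun do rewrite normc_geometric//.
case: p p1 => [r|_|//]; last first.
  rewrite unlock; case: ifPn => // _.
  apply: (@le_lt_trans _ _ 1%E); last exact: ltry.
  apply/ess_supP/nearW => n /=.
  by rewrite lee_fin ger0_norm ?exprn_ge0 ?exprn_ile1 ?ltW.
rewrite lee_fin => r1; have r0 : 0 < r by exact: lt_le_trans r1.
rewrite Lnorm_counting//; apply: poweR_lty.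
apply: (@le_lt_trans _ _ (\sum_(0 <= k <oo) (t ^+ k)%:E)%E).
  apply: lee_nneseries => [n _ _|n _] /=; first by rewrite lee_fin powR_ge0.
  rewrite lee_fin ger0_norm ?exprn_ge0 ?(ltW t0)// ge1r_powR//.
  by rewrite exprn_gt0//= exprn_ile1 ?ltW.
have -> : (\sum_(0 <= k <oo) (t ^+ k)%:E)%E =
    limn (EFin \o series (geometric 1 t)).
  congr (limn _); apply/funext => n; rewrite sumEFin; congr EFin.
  by apply: eq_bigr => k _; rewrite /= mul1r.
rewrite EFin_lim ?ltry//.
by apply: is_cvg_geometric_series; rewrite ger0_norm// ltW.
Qed.

End SequenceSpaces.

(** * Embedding complex sequences in an interval *)

Section Continuum.
Context {R : realType}.
Implicit Type b : nat -> bool.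

Let digit_sum b n : R := \sum_(k < n) (b k)%:R * 3^-1 ^+ k.+1.

(** The gain from [n] to [m] is at most the geometric sum of the [3^-1 ^+ k.+1]
    for [n <= k < m]. *)
Let digit_sum_le b n m : (n <= m)%N ->
  digit_sum b n <= digit_sum b m <=
    digit_sum b n + (3^-1 ^+ n - 3^-1 ^+ m) / 2.
Proof.
move=> /subnKC <-; elim: (m - n)%N => [|k /andP[IHl IHu]].
  by rewrite addn0 subrr mul0r addr0 lexx.
have -> : digit_sum b (n + k.+1) =
    digit_sum b (n + k) + (b (n + k)%N)%:R * 3^-1 ^+ (n + k).+1.
  by rewrite addnS /digit_sum big_ord_recr.
have : 0 < 3^-1 ^+ (n + k) :> R by rewrite exprn_gt0// invr_gt0.
rewrite addnS exprS; move: (3^-1 ^+ (n + k)) IHl IHu => z IHl IHu z0.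
by case: (b _); rewrite /= ?mulr1n ?mulr0n; apply/andP; split; lra.
Qed.

(** The real with ternary digits [b]. Base 3 rather than 2 makes the expansion
    by digits 0 and 1 unique. *)
Definition ternary_value b : R := sup (range (digit_sum b)).

Let digit_sum_ternary b n :
  digit_sum b n <= ternary_value b <= digit_sum b n + 3^-1 ^+ n / 2.
Proof.
have ub m : digit_sum b m <= digit_sum b n + 3^-1 ^+ n / 2.
  have p k : 0 < 3^-1 ^+ k :> R by rewrite exprn_gt0// invr_gt0.
  have [/(digit_sum_le b)/andP[_ le_m]|/ltnW/(digit_sum_le b)/andP[le_m _]] :=
    leqP n m.
    by have := p m; lra.
  by have := p n; lra.
apply/andP; split.
  apply: ub_le_sup; last by exists n.
  by exists (digit_sum b n + 3^-1 ^+ n / 2) => _ [m _ <-].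
apply: ge_sup; first by exists (digit_sum b 0), 0%N.
by move=> _ [m _ <-].
Qed.

Lemma ternary_value_bounds b : 0 <= ternary_value b <= 1 / 2.
Proof.
by have := digit_sum_ternary b 0; rewrite /digit_sum big_ord0 add0r expr0.
Qed.

(** At the first index [m] where the digits differ, the digit 1 contributes
    [3^-1 ^+ m.+1], while all later digits together contribute at most half of
    it. *)
Lemma ternary_value_inj : injective ternary_value.
Proof.
move=> b b' bb'; apply/funext => n; apply/eqP; apply: contrapT => /negP nbb'.
have [m nbm min_m] := ex_minnP (ex_intro (fun n => b n != b' n) _ nbb').
have same : digit_sum b m = digit_sum b' m.
  apply: eq_bigr => k _; congr (_%:R * _); congr nat_of_bool.
  apply/eqP; apply: contraT => /min_m; rewrite leqNgt.
  by rewrite ltn_ord.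
have p : 0 < 3^-1 ^+ m :> R by rewrite exprn_gt0// invr_gt0.
have := digit_sum_ternary b m.+1; have := digit_sum_ternary b' m.+1.
rewrite /digit_sum !big_ord_recr -!/(digit_sum _ _) same -bb' /= exprS.
move: nbm; case: (b m); case: (b' m) => //= _ ? ?; lra.
Qed.

(** The Dedekind cuts of the real and imaginary parts of all coordinates,
    recorded in one binary sequence through a numbering of the triples made of
    an index, the choice of a part and a rational. *)
Definition rational_cuts (x : nat -> R[i]) : nat -> bool := fun k =>
  if choice.unpickle k is Some (n, part, q) then
    ratr q < if part then complex.Re (x n) else complex.Im (x n)
  else false.

Lemma rational_cuts_inj : injective rational_cuts.
Proof.
have cut (u v : R) : (forall q : rat, (ratr q < u) = (ratr q < v)) -> u = v.
  wlog : u v / u <= v => [wl uv|].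
    by case: (leP u v) => [/wl|/ltW/wl] ->.
  rewrite le_eqVlt => /orP[/eqP//|/rat_in_itvoo[q]].
  by rewrite in_itv/= => /andP[uq qv] /(_ q); rewrite qv ltNge (ltW uq).
move=> x y xy; apply/funext => n.
have part p q : (ratr q < if p then complex.Re (x n) else complex.Im (x n)) =
    (ratr q < if p then complex.Re (y n) else complex.Im (y n)).
  have := congr1 (fun b => b (choice.pickle (n, p, q))) xy.
  by rewrite /rational_cuts choice.pickleK.
have := cut _ _ (part true); have := cut _ _ (part false).
by case: (x n) (y n) => [a b] [a' b'] /= -> ->.
Qed.

(** The values of [ternary_value] lie between 0 and 1/2; the shift by 1/4 moves
    them into the open interval of admissible rates. *)
Lemma complex_sequences_embed :
  exists2 f : (nat -> R[i]) -> R, injective f & forall x, 0 < f x < 1.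
Proof.
exists (fun x => ternary_value (rational_cuts x) + 1 / 4).
  by move=> x y /addIr/ternary_value_inj/rational_cuts_inj.
by move=> x; have := ternary_value_bounds (rational_cuts x); lra.
Qed.

End Continuum.

(** * Maximal lineability *)

(** The argument is the same for all linear spaces of sequences that contain
    the geometric ones; it is carried out once, for c0 and the l^p alike. *)
Lemma maximal_lineable_of_geometric (R : realType) (X : set (nat -> R[i])) :
  linear_subspace X -> geometric_family `<=` X -> maximal_lineable X (Z X).
Proof.
move=> Xsub GX; have spanX := linear_span_min _ _ Xsub GX.
exists (linear_span geometric_family); split=> //.
- exact: linear_span_subspace.
- move=> v Gv; have Xv := spanX _ Gv; move: Gv Xv => [s [c [sG ->]]] Xv.
  have [[u us cu0]|c0] := pselect (exists2 u, u \in s & c u != 0).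
    by left; split=> //; exact: geometric_combination_finite_zeros us cu0.
  right; rewrite /= big_seq big1// => u us.
  have [->|cu0] := eqVneq (c u) 0; first by rewrite scale0r.
  by case: c0; exists u.
have [B [GB [indB spanB]]] :=
  hamel_basis_extension _ _ Xsub GX geometric_family_independent.
exists geometric_family, B; split=> //.
  by split=> //; exact: geometric_family_independent.
apply: Cantor_Bernstein; first exact: subset_card_le.
have [f f_inj f01] := @complex_sequences_embed R.
have gf_inj : {in B &, injective (geometric_sequence \o f)}.
  by move=> x y _ _ /geometric_sequence_inj/f_inj.
rewrite -(card_le_eql (inj_card_eq gf_inj)).
by apply: subset_card_le => _ [x _ <-]; exists (f x) => //; exact: f01.
Qed.

Theorem corollary2p2 (R : realType) (X : set (nat -> R[i]))
    (hX : X = c0 R \/ exists p : \bar R, (1%:E <= p)%E /\ X = ell p) :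
  maximal_lineable X (Z X).
Proof.
apply: maximal_lineable_of_geometric.
  by case: hX => [->|[p [p1 ->]]]; [exact: c0_subspace|exact: ell_subspace].
move=> _ [t t01 <-].
by case: hX => [->|[p [p1 ->]]]; [exact: c0_geometric|exact: ell_geometric].
Qed.
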